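(* Let $n\ge2$, $G=SU(n,1)$, $K\cong U(n)$ its maximal compact subgroup, and let $\Lambda\in\mathcal C_{\mathrm{hol}}$. For $k=1,\dots,n$ let $\lambda_k=(n+1)e_k-\sum_{j=1}^ne_j\in\mathfrak t$. Then $$\Delta_K(G\cdot\Lambda)=\bigl\{\xi\in\mathfrak t_+^*:\ \langle\lambda_1,\xi\rangle\ge\langle\lambda_1,\Lambda\rangle\ge\langle\lambda_2,\xi\rangle\ge\langle\lambda_2,\Lambda\rangle\ge\dots\ge\langle\lambda_n,\xi\rangle\ge\langle\lambda_n,\Lambda\rangle\bigr\}.$$
   Context: $K=\{\mathrm{diag}(g,\det g^{-1}):g\in U(n)\}\cong U(n)$; $T$ is the torus of diagonal matrices of $U(n)$, with Lie algebra $\mathfrak t$; $(e_1^*,\dots,e_n^* )$ is the basis of $\mathfrak t^*$ with $e_j^*(i\,\mathrm{diag}(h_1,\dots,h_n))=h_j$, and $(e_1,\dots,e_n)$ is the dual basis of $\mathfrak t$. Roots $\alpha\in\mathfrak t^*$ are defined by $[H,X]=i\alpha(H)X$, $H\in\mathfrak t$. The positive compact roots are $e_i^*-e_j^*$, $1\le i<j\le n$, with Weyl chamber $\mathfrak t_+^*=\{\xi_1\ge\dots\ge\xi_n\}$. The positive noncompact roots (for the chosen invariant complex structure on $G/K$) are $\mathfrak R_n^+=\{\beta_k=e_k^*+\sum_{j=1}^ne_j^*:k=1,\dots,n\}$. The holomorphic chamber is $\mathcal C_{\mathrm{hol}}=\{\xi\in\mathfrak t_+^*:(\beta,\xi)>0\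 \forall\beta\in\mathfrak R_n^+\}$, $(\cdot,\cdot)$ being the inner product induced (up to sign) by the Killing form of $\mathfrak g$. As usual $\mathfrak t^*\subset\mathfrak k^*\subset\mathfrak g^*$ via the Killing form. $G\cdot\Lambda$ is the coadjoint orbit, $\Phi_K:G\cdot\Lambda\to\mathfrak k^*$ is the restriction of the projection $\mathfrak g^*\to\mathfrak k^*$, and $\Delta_K(G\cdot\Lambda)=\Phi_K(G\cdot\Lambda)\cap\mathfrak t_+^*$. *)

(* Defs.v *)
From HB Require Import structures.
From mathcomp Require Import all_boot all_order all_algebra.
From mathcomp Require Import complex.
From mathcomp Require Import classical_sets reals.

Set Implicit Arguments.
Unset Strict Implicit.
Unset Printing Implicit Defensive.

Import Order.TTheory GRing.Theory Num.Theory.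
Local Open Scope ring_scope.
Local Open Scope complex_scope.
Local Open Scope sesquilinear_scope.

(* 'M[R[i]]_m with its structure of vector space over R (instead of R[i]). *)
Definition cmx (R : realType) (m : nat) : Type := 'M[R[i]]_m.

Section RealStructure.
Variables (R : realType) (m : nat).

HB.instance Definition _ := GRing.Zmodule.copy (cmx R m) 'M[R[i]]_m.

Definition cmx_scale (a : R) (A : cmx R m) : cmx R m :=
  a%:C *: (A : 'M[R[i]]_m).

Fact cmx_scaleA a b A : cmx_scale a (cmx_scale b A) = cmx_scale (a * b) A.
Proof. by rewrite /cmx_scale scalerA rmorphM. Qed.

Fact cmx_scale1 : left_id 1 cmx_scale.
Proof. by move=> A; rewrite /cmx_scale rmorph1 scale1r. Qed.

Fact cmx_scaleDr : right_distributive cmx_scale +%R.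
Proof. by move=> a A B; rewrite /cmx_scale scalerDr. Qed.

Fact cmx_scaleDl A : {morph cmx_scale^~ A : a b / a + b}.
Proof. by move=> a b; rewrite /cmx_scale rmorphD scalerDl. Qed.

HB.instance Definition _ := GRing.Zmodule_isLmodule.Build R (cmx R m)
  cmx_scaleA cmx_scale1 cmx_scaleDr cmx_scaleDl.

Lemma cmx_scaleE (a : R) (A : cmx R m) :
  a *: A = (a%:C *: (A : 'M[R[i]]_m)) :> 'M[R[i]]_m.
Proof. by []. Qed.

Definition cmx_coord (A : cmx R m) : 'rV[R]_(m * m + m * m) :=
  row_mx (mxvec (map_mx (@complex.Re R) A)) (mxvec (map_mx (@complex.Im R) A)).

Definition cmx_of_coord (v : 'rV[R]_(m * m + m * m)) : cmx R m :=
  \matrix_(i, j) (vec_mx (lsubmx v) i j +i* vec_mx (rsubmx v) i j).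

Fact cmx_coord_linear : linear cmx_coord.
Proof.
move=> a A B; rewrite /cmx_coord scale_row_mx add_row_mx -!linearP.
congr (row_mx (mxvec _) (mxvec _)); apply/matrixP => i j; rewrite !mxE /=.
  by case: (A i j) (B i j) => [x y] [z t] /=; rewrite mul0r subr0.
by case: (A i j) (B i j) => [x y] [z t] /=; rewrite mul0r addr0.
Qed.

Fact cmx_coord_bij : bijective cmx_coord.
Proof.
exists cmx_of_coord => [A|v].
  apply/matrixP => i j.
  by rewrite mxE row_mxKl row_mxKr !mxvecK !mxE; case: (A i j).
rewrite -[RHS]hsubmxK -[lsubmx v in RHS]vec_mxK -[rsubmx v in RHS]vec_mxK.
by congr (row_mx (mxvec _) (mxvec _)); apply/matrixP => i j; rewrite !mxE.
Qed.

HB.instance Definition _ := Lmodule_hasFinDim.Build R (cmx R m)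
  (exist2 _ _ cmx_coord cmx_coord_linear cmx_coord_bij).

End RealStructure.

Definition dualsp (R : realType) (V : vectType R) := 'Hom(V, R^o).

Definition lftrace (R : realType) (V : vectType R) (f : 'End(V)) : R :=
  \sum_i coord (vbasis {:V}) i (f (vbasis {:V})`_i).

Section SUn1.
Variables (R : realType) (n : nat).
Local Notation C := R[i].
Local Notation M := 'M[C]_(n + 1).
Implicit Types A B : M.

Definition J : M := block_mx 1%:M 0 0 (- 1%:M).

Definition SU : set M :=
  [set g | g ^t* *m J *m g = J /\ \det g = 1].

Let conj_real (a : R) : Num.conj (a%:C : C) = a%:C.
Proof. exact: conjc_real. Qed.

Definition u_op (A : cmx R n) : cmx R n := (A : 'M[C]_n) ^t* + (A : 'M[C]_n).

Definition su_op (A : cmx R (n + 1)) : cmx R (n + 1) :=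
  (A : M) ^t* *m J + J *m (A : M).

Definition tr_op (A : cmx R (n + 1)) : cmx R 1 := (\tr (A : M))%:M.

Fact u_op_linear : linear u_op.
Proof.
move=> a A B; apply/matrixP => i j; rewrite !mxE rmorphD rmorphM /=.
by rewrite conj_real mulrDr addrACA.
Qed.
HB.instance Definition _ := GRing.isLinear.Build R _ _ _ u_op u_op_linear.

Fact su_op_linear : linear su_op.
Proof.
move=> a A B; rewrite /su_op !cmx_scaleE.
have -> : ((a%:C *: (A : M) + (B : M)) : M) ^t*
    = a%:C *: (A : M) ^t* + (B : M) ^t*.
  by apply/matrixP => i j; rewrite !mxE rmorphD rmorphM /= conj_real.
by rewrite mulmxDl mulmxDr -scalemxAl -scalemxAr addrACA -scalerDr.
Qed.
HB.instance Definition _ := GRing.isLinear.Build R _ _ _ su_op su_op_linear.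

Fact tr_op_linear : linear tr_op.
Proof.
move=> a A B; rewrite /tr_op !cmx_scaleE mxtraceD mxtraceZ raddfD /=.
by rewrite -scale_scalar_mx.
Qed.
HB.instance Definition _ := GRing.isLinear.Build R _ _ _ tr_op tr_op_linear.

Definition u_space : {vspace cmx R n} := lker (linfun u_op).

Definition su_space : {vspace cmx R (n + 1)} :=
  (lker (linfun su_op) :&: lker (linfun tr_op))%VS.

Definition su := subvs_of su_space.

Lemma mem_u (A : 'M[C]_n) :
  ((A : cmx R n) \in u_space) = (A ^t* + A == 0).
Proof. by rewrite memv_ker lfunE. Qed.

Lemma mem_su A :
  ((A : cmx R (n + 1)) \in su_space) =
  (A ^t* *m J + J *m A == 0) && (\tr A == 0).
Proof.
rewrite memv_cap !memv_ker !lfunE /= /tr_op; congr (_ && _).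
apply/eqP/eqP => [/matrixP/(_ 0 0)|->]; first by rewrite !mxE.
by apply/matrixP => i j; rewrite !mxE mul0rn.
Qed.

Definition su_mx (X : su) : M := vsval X.

Definition to_su (A : M) : su := vsproj su_space (A : cmx R (n + 1)).

Lemma to_suK A : (A : cmx R (n + 1)) \in su_space -> su_mx (to_su A) = A.
Proof. exact: vsprojK. Qed.

Fact su_mx_linear a (X Y : su) :
  su_mx (a *: X + Y) = a%:C *: su_mx X + su_mx Y.
Proof. by []. Qed.

Fact to_su_linear a A B : to_su (a%:C *: A + B) = a *: to_su A + to_su B.
Proof. exact: (linearP (vsproj su_space) a (A : cmx R _) B). Qed.

Lemma su_mxP (X : su) :
  (su_mx X) ^t* *m J + J *m su_mx X = 0 /\ \tr (su_mx X) = 0.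
Proof.
have := subvsP X; rewrite [vsval X \in _](mem_su (su_mx X)).
by case/andP => /eqP-> /eqP->.
Qed.

(* The projection [to_su] is harmless in [ad_fun], [Ad_fun], [u_to_su]: see
   [ad_mx], [Ad_mx], [u_to_su_mx]. *)
Definition ad_fun (X Y : su) : su :=
  to_su (su_mx X *m su_mx Y - su_mx Y *m su_mx X).

Fact ad_fun_linear X : linear (ad_fun X).
Proof.
move=> a Y Z; rewrite /ad_fun su_mx_linear -to_su_linear; congr to_su.
by rewrite mulmxDl mulmxDr -scalemxAl -scalemxAr scalerBr opprD addrACA.
Qed.
HB.instance Definition _ X :=
  GRing.isLinear.Build R _ _ _ (ad_fun X) (ad_fun_linear X).

Definition ad (X : su) : 'End(su) := linfun (ad_fun X).

Definition Ad_fun (g : M) (X : su) : su := to_su (g *m su_mx X *m invmx g).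

Fact Ad_fun_linear g : linear (Ad_fun g).
Proof.
move=> a X Y; rewrite /Ad_fun su_mx_linear -to_su_linear; congr to_su.
by rewrite mulmxDr mulmxDl -scalemxAr -scalemxAl.
Qed.
HB.instance Definition _ g :=
  GRing.isLinear.Build R _ _ _ (Ad_fun g) (Ad_fun_linear g).

Definition Ad (g : M) : 'End(su) := linfun (Ad_fun g).

Definition coadjoint (g : M) (f : dualsp su) : dualsp su :=
  (f \o Ad (invmx g))%VF.

Let conjtM p q r (A : 'M[C]_(p, q)) (B : 'M[C]_(q, r)) :
  (A *m B) ^t* = B ^t* *m A ^t*.
Proof. by rewrite trmx_mul map_mxM. Qed.

Lemma ad_mx X Y : su_mx (ad X Y) = su_mx X *m su_mx Y - su_mx Y *m su_mx X.
Proof.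
rewrite lfunE /= to_suK // mem_su; apply/andP; split; last first.
  by rewrite raddfB /= mxtrace_mulC subrr.
have [/eqP + _] := su_mxP X; have [/eqP + _] := su_mxP Y.
rewrite !addr_eq0 => /eqP hY /eqP hX; rewrite raddfB /= map_mxB !conjtM.
rewrite mulmxBl -!mulmxA hX hY !mulmxN !mulmxA hX hY !mulNmx !opprK.
by rewrite mulmxBr !mulmxA opprB.
Qed.

Lemma Ad_mx g X : SU g -> su_mx (Ad g X) = g *m su_mx X *m invmx g.
Proof.
case=> gJ dg; have gU : g \in unitmx by rewrite unitmxE dg unitr1.
have [/eqP + tX] := su_mxP X; rewrite addr_eq0 => /eqP hX.
rewrite lfunE /= to_suK // mem_su; apply/andP; split; last first.
  by rewrite mxtrace_mulC mulmxA mulVmx // mul1mx tX.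
have gtU : g ^t* \in unitmx by rewrite map_unitmx unitmx_tr.
have Jg : J *m g = invmx (g ^t*) *m J by rewrite -[in RHS]gJ -!mulmxA mulKmx.
have gJ' : g ^t* *m J = J *m invmx g by rewrite -[in RHS]gJ mulmxK.
have it : (invmx g) ^t* = invmx (g ^t*) by rewrite trmx_inv map_invmx.
rewrite !conjtM it !mulmxA Jg -!mulmxA gJ' -mulmxDr !mulmxA -mulmxDl.
by rewrite hX addNr mul0mx mulmx0.
Qed.

Definition killing (X Y : su) : R^o := lftrace (ad X \o ad Y)%VF.

Fact killing_linear X : linear (killing X).
Proof.
move=> a Y Z; rewrite /killing /lftrace scaler_sumr -big_split /=.
apply: eq_bigr => i _; rewrite !comp_lfunE.
have -> : ad (a *: Y + Z) = a *: ad Y + ad Z.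
  apply/lfunP => W; rewrite !(add_lfunE, scale_lfunE) !lfunE /= /ad_fun.
  rewrite su_mx_linear -to_su_linear; congr to_su.
  by rewrite mulmxDl mulmxDr -scalemxAl -scalemxAr scalerBr opprD addrACA.
by rewrite !(add_lfunE, scale_lfunE) !linearP.
Qed.
HB.instance Definition _ X :=
  GRing.isLinear.Build R _ _ _ (killing X) (killing_linear X).

Lemma killingC X Y : killing X Y = killing Y X.
Proof.
rewrite /killing /lftrace; set b := vbasis _.
have bP (v : su) : v = \sum_j coord b j v *: b`_j.
  exact: coord_vbasis (memvf v).
have E (f g : 'End(su)) : \sum_i coord b i ((f \o g)%VF b`_i) =
    \sum_(i < \dim {:su}) \sum_j coord b j (g b`_i) * coord b i (f b`_j).
  apply: eq_bigr => i _; rewrite comp_lfunE {1}(bP (g _)) !linear_sum.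
  by apply: eq_bigr => j _; rewrite !linearZ.
rewrite !E exchange_big /=; apply: eq_bigr => i _; apply: eq_bigr => j _.
by rewrite mulrC.
Qed.

Definition killing_form (X : su) : dualsp su := linfun (killing X).

Fact killing_form_linear : linear killing_form.
Proof.
move=> a X Y; apply/lfunP => Z; rewrite add_lfunE scale_lfunE !lfunE /=.
by rewrite ![killing _ Z]killingC linearP.
Qed.
HB.instance Definition _ :=
  GRing.isLinear.Build R _ _ _ killing_form killing_form_linear.

Definition restr (U : {vspace su}) (f : dualsp su) : dualsp (subvs_of U) :=
  (f \o linfun vsval)%VF.

(* The differential of U(n) -> SU(n,1), g |-> diag(g, det g^-1). *)
Definition u_to_su (A : cmx R n) : su :=
  to_su (block_mx (A : 'M[C]_n) 0 0 (- \tr (A : 'M[C]_n))%:M).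

Fact u_to_su_linear : linear u_to_su.
Proof.
move=> a A B; rewrite /u_to_su -to_su_linear !cmx_scaleE; congr to_su.
rewrite scale_block_mx add_block_mx !scaler0 !addr0; congr block_mx.
by rewrite mxtraceD mxtraceZ opprD raddfD /= scale_scalar_mx mulrN.
Qed.
HB.instance Definition _ := GRing.isLinear.Build R _ _ _ u_to_su u_to_su_linear.

Lemma u_to_su_mx (A : 'M[C]_n) : (A : cmx R n) \in u_space ->
  su_mx (u_to_su A) = block_mx A 0 0 (- \tr A)%:M.
Proof.
rewrite mem_u => /eqP hA; rewrite to_suK // mem_su mxtrace_block.
rewrite mxtrace_scalar mulr1n subrr eqxx andbT /J tr_block_mx map_block_mx.
rewrite !mulmx_block !trmx0 !map_mx0.
rewrite !(mulmx0, mul0mx, addr0, add0r, mulmx1, mul1mx) add_block_mx hA.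
have tA : Num.conj (\tr A) + \tr A = 0.
  have <- : \tr (0 : 'M[C]_n) = 0 by rewrite raddf0.
  by rewrite -hA mxtraceD -map_trmx mxtrace_tr trace_map_mx.
rewrite mulmxN mulNmx mulmx1 mul1mx tr_scalar_mx map_scalar_mx !addr0.
rewrite -opprD -raddfD /= rmorphN /= -opprD tA.
by rewrite !oppr0 raddf0 oppr0 block_mx_const.
Qed.

Definition idiag (h : 'rV[R]_n) : cmx R n :=
  'i *: diag_mx (map_mx (real_complex R) h).

Fact idiag_linear : linear idiag.
Proof.
move=> a h h'; rewrite cmx_scaleE /idiag map_mxD raddfD /= scalerDr.
by rewrite map_mxZ linearZ /= !scalerA mulrC.
Qed.
HB.instance Definition _ := GRing.isLinear.Build R _ _ _ idiag idiag_linear.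

(* The Lie algebras of K and T, as subspaces of su(n,1). *)
Definition k_space : {vspace su} := (linfun u_to_su @: u_space)%VS.
Definition t_space : {vspace su} := limg (linfun (u_to_su \o idiag)).

Definition tor := subvs_of t_space.

Definition e_t (j : 'I_n) : tor :=
  vsproj t_space (u_to_su (idiag (delta_mx 0 j))).

Definition estar_fun (j : 'I_n) (H : tor) : R^o :=
  complex.Im (su_mx (vsval H) (lshift 1 j) (lshift 1 j)).

Fact estar_fun_linear j : linear (estar_fun j).
Proof.
move=> a H H'; rewrite /estar_fun linearP su_mx_linear !mxE /=.
case: (su_mx (vsval H) _ _) (su_mx (vsval H') _ _) => [x y] [z t] /=.
by rewrite mul0r addr0.
Qed.
HB.instance Definition _ j :=
  GRing.isLinear.Build R _ _ _ (estar_fun j) (estar_fun_linear j).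

Definition estar (j : 'I_n) : dualsp tor := linfun (estar_fun j).

Lemma mem_u_idiag h : idiag h \in u_space.
Proof.
rewrite mem_u; apply/eqP/matrixP => i j; rewrite !mxE eq_sym.
case: eqP => [->|_]; last by rewrite mulr0n mulr0 rmorph0 addr0.
rewrite !mulr1n rmorphM /= conj_real -mulrDl.
rewrite (_ : Num.conj ('i : C) = - 'i) ?addNr ?mul0r //.
by apply/eqP; rewrite eq_complex /= oppr0 !eqxx.
Qed.

Lemma estar_idiag j h :
  estar j (vsproj t_space (u_to_su (idiag h))) = h 0 j.
Proof.
rewrite lfunE /= /estar_fun vsprojK; last first.
  by apply/memv_imgP; exists h; rewrite ?memvf // lfunE.
rewrite u_to_su_mx ?mem_u_idiag // block_mxEul !mxE eqxx mulr1n /=.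
by rewrite mul0r add0r mul1r.
Qed.

Lemma estar_e j k : estar j (e_t k) = (j == k)%:R.
Proof. by rewrite estar_idiag mxE eqxx. Qed.

Definition lambda_t (k : 'I_n) : tor := n.+1%:R *: e_t k - \sum_j e_t j.

(* t^* ~ t via the Killing form: [sharp xi] is the H in t such that
   killing H H' = xi H' for all H' in t. *)
Definition flat_fun (H : tor) : dualsp tor :=
  restr t_space (killing_form (vsval H)).
Fact flat_fun_linear : linear flat_fun.
Proof.
move=> a H H'; rewrite /flat_fun !linearP /=; apply/lfunP => Z.
by rewrite !(comp_lfunE, add_lfunE, scale_lfunE).
Qed.
HB.instance Definition _ :=
  GRing.isLinear.Build R _ _ _ flat_fun flat_fun_linear.

Definition flat : 'Hom(tor, dualsp tor) := linfun flat_fun.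
Definition sharp (xi : dualsp tor) : tor := (flat^-1)%VF xi.

(* The inclusions of t^* in g^* and in k^* via the Killing form: xi becomes the
   functional killing (sharp xi) on g, resp. on k. *)
Definition t_to_g (xi : dualsp tor) : dualsp su :=
  killing_form (vsval (sharp xi)).
Definition t_to_k (xi : dualsp tor) : dualsp (subvs_of k_space) :=
  restr k_space (t_to_g xi).

(* The sign makes it positive definite: the Killing form is negative definite
   on t. *)
Definition inner_t (xi eta : dualsp tor) : R :=
  - (killing (vsval (sharp xi)) (vsval (sharp eta)) : R).

(* The duality bracket <H, xi>, as a number in R rather than R^o. *)
Definition pairing (H : tor) (xi : dualsp tor) : R := xi H.

(* The coordinates of xi in the basis (estar j) are xi_j = <e_t j, xi>. *)
Definition chamber : set (dualsp tor) :=
  [set xi | forall i j : 'I_n, (i <= j)%N ->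
    pairing (e_t j) xi <= pairing (e_t i) xi].

Definition beta (k : 'I_n) : dualsp tor := estar k + \sum_j estar j.

Definition noncompact_roots : set (dualsp tor) := range beta.

Definition Chol : set (dualsp tor) :=
  [set xi | chamber xi /\
    forall b, noncompact_roots b -> 0 < inner_t b xi].

Definition coadjoint_orbit (L : dualsp tor) : set (dualsp su) :=
  [set coadjoint g (t_to_g L) | g in SU].

Definition Phi_K (f : dualsp su) : dualsp (subvs_of k_space) :=
  restr k_space f.

Definition Delta_K (L : dualsp tor) : set (dualsp tor) :=
  [set xi | chamber xi /\ (Phi_K @` coadjoint_orbit L)%classic (t_to_k xi)].

End SUn1.

(* Main.v *)
From HB Require Import structures.
Require Import Defs.
From mathcomp Require Import all_boot all_order all_algebra.
From mathcomp Require Import complex classical_sets reals.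
From mathcomp Require Import ring zify.

(** Via the Killing form, which is 2(n+1) Re tr(XY), Lambda and xi become
    i diag(x, z) and i diag(y, -) with x_1 <= .. <= x_n < z = - sum x, and
    lambda_k pairs to a fixed negative multiple of x_k, resp. y_k. Then xi lies
    in Delta_K if and only if some g in SU(n,1) makes diag(y) the upper-left
    block of g diag(x, z) g^-1, and the claim is
    y_1 <= x_1 <= y_2 <= .. <= y_n <= x_n.

    Necessity: the first n rows of g span a J-positive space on which the forms
    sum |w_i|^2 - |w_(n+1)|^2 and sum x_i |w_i|^2 - z |w_(n+1)|^2 are diagonal
    with entries 1 and y; intersecting suitable subspaces as in the
    Courant-Fischer principle gives the inequalities.

    Sufficiency: for strict interlacing, with chi(t) = (t - z) prod (t - x_i),
    the rows sqrt(b_j c_t) / (a_t - y_j) work, where a = (x, z),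
    b_j = chi(y_j) / prod_(m != j) (y_j - y_m) and
    c_t = |prod_m (a_t - y_m) / chi'(a_t)|; every identity needed is an instance
    of Lagrange interpolation. A coincidence y_a = x_b splits off a
    one-dimensional summand, which reduces n. *)

Set Implicit Arguments.
Unset Strict Implicit.
Unset Printing Implicit Defensive.

Import Order.TTheory GRing.Theory Num.Theory.
Local Open Scope ring_scope.

(** * Sums over option types and Lagrange interpolation *)

Lemma big_option (R : Type) (idx : R) (op : Monoid.law idx) (T : finType)
    (P : pred (option T)) (F : option T -> R) :
  \big[op/idx]_(t | P t) F t =
  op (if P None then F None else idx) (\big[op/idx]_(i | P (Some i)) F (Some i)).
Proof.
have -> : index_enum (option T) = None :: map Some (index_enum T).
  by rewrite ![index_enum _]unlock [in LHS]unlock.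
by rewrite big_mkcond big_cons big_map -big_mkcond.
Qed.

Section Lagrange.
Variable F : fieldType.

(** Each basis polynomial [B t] is monic of degree [#|T| - 1], so the left side is the top
    coefficient of the polynomial interpolating [P] at the nodes, which is [P] itself. *)
Lemma lagrange_coef (T : finType) (a : T -> F) (P : {poly F}) :
    injective a -> (size P <= #|T|)%N ->
  \sum_t P.[a t] / \prod_(l | l != t) (a t - a l) = P`_(#|T|.-1).
Proof.
move=> a_inj sP.
pose B t : {poly F} := \prod_(l | l != t) ('X - (a l)%:P).
have sB t : size (B t) = #|T|.
  rewrite /B -big_filter size_prod_XsubC -sum1_size big_filter.
  rewrite (_ : \sum_(i | i != t) 1 = #|predC1 t|)%N; last by rewrite -sum1_card.
  by rewrite cardC1 prednK //; apply/card_gt0P; exists t.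
have mB t : B t \is monic by apply: monic_prod_XsubC.
pose L := \sum_t (P.[a t] / \prod_(l | l != t) (a t - a l)) *: B t.
have PL : P = L.
  apply/eqP; rewrite -subr_eq0; apply/eqP.
  apply: (@roots_geq_poly_eq0 _ _ (map a (enum T))); last 1 first.
  - rewrite size_map -cardE (leq_trans (size_polyD _ _)) // size_polyN geq_max sP /=.
    apply: (leq_trans (size_sum _ _ _)); apply/bigmax_leqP => t _.
    by rewrite (leq_trans (size_scale_leq _ _)) ?sB.
  - apply/allP => _ /mapP[t _ ->]; rewrite rootE hornerD hornerN horner_sum.
    rewrite (bigD1 t) //= [X in _ - (_ + X)]big1 ?addr0 => [|s st].
      have Bt : (B t).[a t] = \prod_(l | l != t) (a t - a l).
        by rewrite horner_prod; apply: eq_bigr => l _; rewrite hornerXsubC.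
      rewrite hornerZ Bt divfK ?subrr //; apply/prodf_neq0 => l lt.
      by rewrite subr_eq0; apply: contra lt => /eqP/a_inj->.
    rewrite hornerZ horner_prod [X in _ * X](bigD1 t) 1?eq_sym //= hornerXsubC subrr.
    by rewrite mul0r mulr0.
  - by rewrite map_inj_uniq ?enum_uniq.
rewrite [in RHS]PL coef_sum; apply: eq_bigr => t _; rewrite coefZ.
by move/monicP: (mB t); rewrite lead_coefE sB => ->; rewrite mulr1.
Qed.

(** With [y] adjoined as a further node, [P] is too small for its top coefficient to be nonzero; the
    term of [y] moves to the right. *)
Lemma lagrange_pole (T : finType) (a : T -> F) (y : F) (P : {poly F}) :
    injective a -> (forall t, a t != y) -> (size P <= #|T|)%N ->
  \sum_t P.[a t] / ((a t - y) * \prod_(l | l != t) (a t - a l)) =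
  - (P.[y] / \prod_t (y - a t)).
Proof.
move=> a_inj ay sP.
have b_inj : injective (oapp a y).
  move=> [s|] [t|] //=; first by move/a_inj->.
    by move=> E; have := ay s; rewrite E eqxx.
  by move=> E; have := ay t; rewrite -E eqxx.
have := @lagrange_coef _ (oapp a y) P b_inj; rewrite card_option => /(_ (leqW sP)).
rewrite [P`_ _]nth_default // big_option /=.
under [X in _ + X]eq_bigr => t _ do rewrite big_option /=.
by rewrite big_option /= mul1r => /eqP; rewrite addrC addr_eq0 => /eqP <-.
Qed.

End Lagrange.

(* An index set of size n+1 is written [option 'I_n], [None] being the negative
   direction. *)
Definition lorentz_sign (R : numDomainType) (T : Type) (t : option T) : R :=
  if t is Some _ then 1 else -1.
Arguments lorentz_sign R {T} t.

(** * The strictly interlacing case: an explicit Cauchy-type matrix *)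

Section CauchyMatrix.
Variables (R : rcfType) (n : nat) (x y : 'I_n -> R) (z : R).
Hypothesis yx : forall i j : 'I_n, (j <= i)%N -> y j < x i.
Hypothesis xy : forall i j : 'I_n, (i < j)%N -> x i < y j.
Hypothesis xz : forall i, x i < z.

Let a (t : option 'I_n) : R := oapp x z t.

Let x_lt (i j : 'I_n) : (i < j)%N -> x i < x j.
Proof. by move=> ij; apply: lt_trans (xy ij) (yx (leqnn j)). Qed.

Let y_lt (i j : 'I_n) : (i < j)%N -> y i < y j.
Proof. by move=> ij; apply: lt_trans (yx (leqnn i)) (xy ij). Qed.

Let a_inj : injective a.
Proof.
move=> [i|] [j|] //= E; last 2 first.
- by have := xz i; rewrite E ltxx.
- by have := xz j; rewrite E ltxx.
congr Some; apply/val_inj/eqP; case: ltngtP => // /x_lt; by rewrite E ltxx.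
Qed.

Let y_inj : injective y.
Proof.
move=> i j E; apply/val_inj/eqP; case: ltngtP => // /y_lt; by rewrite E ltxx.
Qed.

Let ay t m : a t != y m.
Proof.
case: t => [i|] /=; last first.
  by rewrite gt_eqF // (lt_trans (yx (leqnn m))).
by have [/yx/gt_eqF->|/xy/lt_eqF->] := leqP m i.
Qed.

(** Residues: [- c t] at [a t] of the quotient of the monic polynomial with roots [y] by the one
    with roots [a], and [b j] at [y j] of the inverse quotient. [c] is kept signed: its sign is that
    of [lorentz_sign]. *)
Let c t := - (\prod_m (a t - y m) / \prod_(l | l != t) (a t - a l)).
Let b j := \prod_t (y j - a t) / \prod_(m | m != j) (y j - y m).

Let da t : \prod_(l | l != t) (a t - a l) != 0.
Proof.
apply/prodf_neq0 => l lt; rewrite subr_eq0.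
by apply: contra lt => /eqP/a_inj->.
Qed.

Let dy t m : a t - y m != 0. Proof. by rewrite subr_eq0 ay. Qed.

Let c_gt0 i : 0 < c (Some i).
Proof.
(* For [m != i] the factors of [y m] and [x m] form a positive quotient; the factor of [y i] is
   paired with that of [z], and this negative quotient absorbs the minus sign. *)
rewrite /c (bigD1 i) //= big_option /= -mulf_div -mulNr -prodf_div.
have : 0 < (x i - y i) / (z - x i).
  by rewrite divr_gt0 ?subr_gt0 // yx.
rewrite -mulrN -invrN opprB => ?; rewrite mulr_gt0 //.
apply: prodr_gt0 => m mi; have {}mi : m != i by [].
have [lt_mi|le_im] := ltnP m i.
  by rewrite divr_gt0 // subr_gt0 ?x_lt // yx // ltnW.
have lt_im : (i < m)%N by rewrite ltn_neqAle le_im andbT eq_sym.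
by rewrite -mulrNN -invrN !opprB divr_gt0 // subr_gt0 ?x_lt ?xy.
Qed.

Let c_lt0 : c None < 0.
Proof.
rewrite /c big_option /= mul1r oppr_lt0 -prodf_div prodr_gt0 // => m _.
by rewrite divr_gt0 // subr_gt0 ?xz // (lt_trans _ (xz m)) // yx.
Qed.

Let b_gt0 j : 0 < b j.
Proof.
rewrite /b big_option /= (bigD1 j) //= mulrA -mulrA -prodf_div mulr_gt0 //.
  by rewrite nmulr_rgt0 subr_lt0 ?yx // (lt_trans (yx (leqnn j))).
apply: prodr_gt0 => m mj.
have [lt_jm|le_mj] := ltnP j m.
  by rewrite -mulrNN -invrN !opprB divr_gt0 // subr_gt0 ?y_lt // yx // ltnW.
have lt_mj : (m < j)%N by rewrite ltn_neqAle le_mj andbT.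
by rewrite divr_gt0 // subr_gt0 ?y_lt ?xy.
Qed.

Let c_sg t : lorentz_sign R t * `|c t| = c t.
Proof.
case: t => [i|] /=; first by rewrite mul1r gtr0_norm.
by rewrite ltr0_norm // mulN1r opprK.
Qed.

Let Q j : {poly R} := \prod_(m | m != j) ('X - (y m)%:P).

Let Q_horner j u : (Q j).[u] = \prod_(m | m != j) (u - y m).
Proof. by rewrite horner_prod; apply: eq_bigr => m _; rewrite hornerXsubC. Qed.

Let size_Q j : size (Q j) = n.
Proof.
rewrite /Q -big_filter size_prod_XsubC -sum1_size big_filter.
rewrite (_ : \sum_(i | i != j) 1 = #|predC1 j|)%N; last by rewrite -sum1_card.
by rewrite cardC1 card_ord prednK // (leq_trans _ (ltn_ord j)).
Qed.

Let c_Q t j : c t = - ((a t - y j) * (Q j).[a t] / \prod_(l | l != t) (a t - a l)).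
Proof. by rewrite /c (bigD1 j) //= Q_horner. Qed.

Let c_sum : \sum_t c t = -1.
Proof.
pose P : {poly R} := \prod_m ('X - (y m)%:P).
have mP : P \is monic by apply: monic_prod_XsubC.
have sP : size P = #|{: option 'I_n}|.
  by rewrite size_prod_XsubC -sum1_size sum1_card card_option.
have := lagrange_coef a_inj (eq_leq sP); rewrite -sP -lead_coefE (monicP mP).
move=> <-; rewrite -sumrN; apply: eq_bigr => t _; congr (- (_ / _)).
by rewrite horner_prod; apply: eq_bigr => m _; rewrite hornerXsubC.
Qed.

(** Dividing by [a t - y j] leaves [Q j], of degree [n - 1], whose coefficient of degree [n]
    vanishes. *)
Let c_sum1 j : \sum_t c t / (a t - y j) = 0.
Proof.
have := lagrange_coef a_inj (_ : size (Q j) <= #|{: option 'I_n}|)%N.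
rewrite size_Q card_option card_ord leqnSn => /(_ isT).
rewrite [RHS]nth_default ?size_Q // => E; rewrite -[RHS]oppr0 -[in RHS]E -sumrN.
apply: eq_bigr => t _; rewrite (c_Q t j) mulNr; congr (- _).
by rewrite mulrAC [_ * (Q j).[_]]mulrC mulfK.
Qed.

Let c_sum2 j k :
  \sum_t c t / ((a t - y j) * (a t - y k)) = (b j)^-1 *+ (j == k).
Proof.
have [<-|jk] := eqVneq j k; last first.
  have ykj : y j - y k != 0.
    by rewrite subr_eq0; apply: contra jk => /eqP/y_inj->.
  (* Partial fractions reduce two distinct poles to [c_sum1]. *)
  rewrite mulr0n (eq_bigr (fun t => (y j - y k)^-1 *
    (c t / (a t - y j) - c t / (a t - y k)))) => [|t _].
    by rewrite -mulr_sumr sumrB !c_sum1 subrr mulr0.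
  by field; rewrite ykj !dy.
(* One factor of the double pole cancels in [c t]; the simple pole left is handled by
   [lagrange_pole] at [y j]. *)
have := @lagrange_pole _ _ a (y j) (Q j) a_inj (ay^~ j).
rewrite size_Q card_option card_ord leqnSn => /(_ isT) E.
rewrite mulr1n /b invf_div -Q_horner -[RHS]opprK -E -sumrN.
apply: eq_bigr => t _; rewrite (c_Q t j).
by field; rewrite dy da.
Qed.

Lemma strictly_interlacing_pseudo_orthogonal :
  exists2 g : option 'I_n -> option 'I_n -> R,
    forall s s', \sum_t lorentz_sign R t * (g s t * g s' t) =
      lorentz_sign R s *+ (s == s')
  & forall j k, \sum_t lorentz_sign R t * oapp x z t * (g (Some j) t * g (Some k) t)
      = y j *+ (j == k).
Proof.
(* The row [None] is constant: weighted by [c], its square norm is -1 by [c_sum], and it is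
   orthogonal to the other rows by [c_sum1]. *)
pose h s t := if s is Some j then Num.sqrt (b j) / (a t - y j) else 1.
pose g s t := h s t * Num.sqrt `|c t|.
have gg s s' t : lorentz_sign R t * (g s t * g s' t) = c t * (h s t * h s' t).
  rewrite -[in RHS]c_sg -[in RHS](@sqr_sqrtr _ `|c t|) // /g; ring.
have sb j : Num.sqrt (b j) * Num.sqrt (b j) = b j.
  by rewrite -expr2 sqr_sqrtr // ltW.
have b0 j : b j != 0 by rewrite gt_eqF.
have hh j k : \sum_t c t * (h (Some j) t * h (Some k) t) = (j == k)%:R.
  transitivity (Num.sqrt (b j) * Num.sqrt (b k) *
      \sum_t c t / ((a t - y j) * (a t - y k))).
    by rewrite mulr_sumr; apply: eq_bigr => t _; rewrite invfM /h; ring.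
  rewrite c_sum2; have [<-|jk] := eqVneq j k; last by rewrite mulr0.
  by rewrite sb divff.
have h0 j : \sum_t c t * h (Some j) t = 0.
  rewrite -[RHS](mulr0 (Num.sqrt (b j))) -[in RHS](c_sum1 j) mulr_sumr.
  by apply: eq_bigr => t _; rewrite /h; ring.
exists g => [s s'|j k].
  under eq_bigr do rewrite gg.
  case: s s' => [j|] [k|] /=; last by under eq_bigr do rewrite !mulr1.
  - by rewrite hh.
  - by under eq_bigr do rewrite mulr1; rewrite h0.
  - by under eq_bigr do rewrite mul1r; rewrite h0.
(* With [a t] written as [y j + (a t - y j)], the first term gives [y j] times the Gram matrix; the
   second cancels the pole and sums to zero by [h0]. *)
transitivity (\sum_t (c t * (h (Some j) t * h (Some k) t) * y j
    + Num.sqrt (b j) * (c t * h (Some k) t))).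
  apply: eq_bigr => t _; rewrite mulrAC gg -/(a t).
  have -> : c t * (h (Some j) t * h (Some k) t) * a t =
    c t * (h (Some j) t * h (Some k) t) * y j +
    c t * ((h (Some j) t * (a t - y j)) * h (Some k) t) by ring.
  have -> : h (Some j) t * (a t - y j) = Num.sqrt (b j) by rewrite divfK.
  by ring.
by rewrite big_split /= -mulr_suml -mulr_sumr h0 hh mulr0 addr0 mulr_natl.
Qed.

End CauchyMatrix.

(** * The weakly interlacing case, by splitting off coincidences *)

Section Interlacing.
Variable R : rcfType.

(** The position of [s] once the index [a] is deleted: the outer [None] marks [a] itself, while
    [Some None] is the negative direction, which is never deleted. *)
Let unlift_option n (a : 'I_n) (s : option 'I_n) : option (option 'I_n.-1) :=
  if s is Some j then omap Some (unlift a j) else Some None.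

Lemma interlacing_pseudo_orthogonal n (x y : 'I_n -> R) (z : R) :
    (forall i j : 'I_n, (j <= i)%N -> y j <= x i) ->
    (forall i j : 'I_n, (i < j)%N -> x i <= y j) ->
    (forall i, x i < z) ->
  exists2 g : option 'I_n -> option 'I_n -> R,
    forall s s', \sum_t lorentz_sign R t * (g s t * g s' t) =
      lorentz_sign R s *+ (s == s')
  & forall j k, \sum_t lorentz_sign R t * oapp x z t * (g (Some j) t * g (Some k) t)
      = y j *+ (j == k).
Proof.
elim: n => [|n IHn] in x y *.
  by move=> _ _ _; apply: strictly_interlacing_pseudo_orthogonal => - [].
move=> yx xy xz.
case: (pickP (fun ab : 'I_n.+1 * 'I_n.+1 => y ab.1 == x ab.2)) => [[a b]|] /=;
    last first.
  move=> ne; apply: strictly_interlacing_pseudo_orthogonal => // i j ij.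
    by rewrite lt_neqAle yx // (ne (j, i)).
  by rewrite lt_neqAle xy // eq_sym (ne (j, i)).
move=> /eqP yaxb.
(* Deleting [y a] and [x b] may shift the two families differently; the inequalities affected pass
   through the common value [y a = x b]. *)
have [i j ij|i j ij|i|g gJ gD] := IHn (x \o lift b) (y \o lift a) => /=.
- have [le|gt] := leqP (lift a j) (lift b i); first exact: yx.
  apply: (@le_trans _ _ (y a)); first rewrite yaxb; apply: yx;
    move: gt; rewrite /= /bump; lia.
- have [lt|ge] := ltnP (lift b i) (lift a j); first exact: xy.
  apply: (@le_trans _ _ (y a)); last rewrite yaxb; apply: xy;
    move: ge; rewrite /= /bump; lia.
- exact: xz.
(* Block sum of [g] and a single entry 1 in row [Some a] and column [Some b]. *)
pose h s t := match unlift_option a s, unlift_option b t with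
  | Some s', Some t' => g s' t' | None, None => 1 | _, _ => 0 end.
have sum_h (f : option 'I_n.+1 -> R) s s' :
    \sum_t f t * (h s t * h s' t) =
    match unlift_option a s, unlift_option a s' with
    | Some r, Some r' => \sum_t f (omap (lift b) t) * (g r t * g r' t)
    | None, None => f (Some b) | _, _ => 0 end.
  rewrite big_option (bigD1_ord b) //= /h /= unlift_none /=.
  under eq_bigr do rewrite liftK /=.
  case: (unlift_option a s) => [r|]; case: (unlift_option a s') => [r'|];
    rewrite ?(mul0r, mulr0, add0r, addr0, mulr1) //.
  - by rewrite big_option.
  - by rewrite big1 // => i _; rewrite !mulr0.
  - by rewrite big1 // => i _; rewrite mul0r mulr0.
  - by rewrite big1 ?addr0 // => i _; rewrite mulr0.
exists h => [s s'|j k].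
  rewrite sum_h.
  have sgh t : lorentz_sign R (omap (lift b) t) = lorentz_sign R t by case: t.
  have SomeE m (i i' : 'I_m) : (Some i == Some i') = (i == i') by [].
  case: s s' => [j|] [k|] //=.
  - case: unliftP => [j' ->|->]; case: unliftP => [k' ->|->] /=.
    + under eq_bigr do rewrite sgh.
      by rewrite gJ /= !SomeE (inj_eq lift_inj).
    + by rewrite SomeE eq_sym (negPf (neq_lift _ _)).
    + by rewrite SomeE (negPf (neq_lift _ _)).
    + by rewrite SomeE eqxx.
  - case: unliftP => [j' _|_] //=.
    by under eq_bigr do rewrite sgh; rewrite gJ.
  - case: unliftP => [j' _|_] //=.
    by under eq_bigr do rewrite sgh; rewrite gJ.
  - by under eq_bigr do rewrite sgh; rewrite gJ.
rewrite sum_h /=.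
case: unliftP => [j' ->|->]; case: unliftP => [k' ->|->] /=.
- rewrite (inj_eq lift_inj) -gD; apply: eq_bigr.
  by case.
- by rewrite eq_sym (negPf (neq_lift _ _)).
- by rewrite (negPf (neq_lift _ _)).
- by rewrite eqxx yaxb mul1r.
Qed.

End Interlacing.

(** * Necessity: interlacing by the min-max principle *)

Section MinMax.
Variables (C : numClosedFieldType) (n : nat).
Variables (x y : 'I_n -> C) (z : C).
Variables (p : 'I_n -> 'I_n -> C) (q : 'I_n -> C).
Hypothesis orth : forall j k,
  \sum_i p j i * (p k i)^* - q j * (q k)^* = (j == k)%:R.
Hypothesis diag : forall j k,
  \sum_i x i * (p j i * (p k i)^*) - z * (q j * (q k)^*) = y j *+ (j == k).

(** Here [u] holds the coordinates of a vector in the span of the rows [(p, q)]; once the squares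
    are expanded, the off-diagonal terms drop by hypothesis. *)
Lemma form_pullback (a : 'I_n -> C) (c : C) (d u : 'I_n -> C) :
    (forall j k, \sum_i a i * (p j i * (p k i)^*) - c * (q j * (q k)^*)
       = d j *+ (j == k)) ->
  \sum_i a i * `|\sum_j u j * p j i| ^+ 2 - c * `|\sum_j u j * q j| ^+ 2
  = \sum_j d j * `|u j| ^+ 2.
Proof.
have sq (f : 'I_n -> C) : `|\sum_j u j * f j| ^+ 2 =
    \sum_j \sum_k (u j * (u k)^*) * (f j * (f k)^*).
  rewrite normCK rmorph_sum mulr_suml; apply: eq_bigr => j _.
  rewrite mulr_sumr; apply: eq_bigr => k _; rewrite rmorphM /=; ring.
move=> E.
transitivity (\sum_j \sum_k (u j * (u k)^*) * (d j *+ (j == k))).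
  rewrite sq mulr_sumr; under eq_bigr do rewrite sq mulr_sumr.
  rewrite exchange_big -sumrB; apply: eq_bigr => j _.
  rewrite mulr_sumr; under eq_bigr do rewrite mulr_sumr.
  rewrite exchange_big -sumrB; apply: eq_bigr => k _.
  rewrite -E mulrBr mulr_sumr; congr (_ - _); last by ring.
  by apply: eq_bigr => i _; ring.
apply: eq_bigr => j _; rewrite (bigD1 j) //= eqxx mulr1n big1 ?addr0.
  by rewrite normCK mulrC.
by move=> k /negPf kj; rewrite eq_sym kj mulr0n mulr0.
Qed.

(** This is [diag] minus [c] times [orth]. Taking for [c] a value [x l] fixes the signs of the
    coefficients on the left. *)
Lemma shifted_form (u : 'I_n -> C) (c : C) :
  \sum_i (x i - c) * `|\sum_j u j * p j i| ^+ 2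
    - (z - c) * `|\sum_j u j * q j| ^+ 2
  = \sum_j (y j - c) * `|u j| ^+ 2.
Proof.
apply: form_pullback => j k; rewrite mulrBl.
rewrite mulrnBl -diag -mulr_natr -orth mulrBr mulr_sumr.
under eq_bigr do rewrite mulrBl.
by rewrite sumrB; ring.
Qed.

(** At most [n - 1] linear conditions on [n] unknowns: the zero column pads them to a singular
    square matrix. *)
Lemma kernel_of_zero_col (A : 'M[C]_n) (c : 'I_n) :
  (forall j, A j c = 0) ->
  exists2 u : 'rV[C]_n, u != 0 & forall i, \sum_j u 0 j * A j i = 0.
Proof.
move=> A0.
have dA : \det A = 0.
  by rewrite (expand_det_col A c) big1 // => j _; rewrite A0 mul0r.
have /det0P[u u0 uA] : \det A == 0 by rewrite dA.
by exists u => // i; have /matrixP/(_ 0 i) := uA; rewrite !mxE.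
Qed.

Hypothesis x_mono : forall i j : 'I_n, (i <= j)%N -> x i <= x j.
Hypothesis y_mono : forall i j : 'I_n, (i <= j)%N -> y i <= y j.
Hypothesis xz : forall i, x i <= z.

Lemma sum_sq_gt0 (u : 'rV[C]_n) : u != 0 -> 0 < \sum_j `|u 0 j| ^+ 2.
Proof.
case/rV0Pn => j uj; rewrite (bigD1 j) //=.
rewrite ltr_pwDl ?exprn_gt0 ?normr_gt0 ?sumr_ge0 // => k _.
by rewrite exprn_ge0.
Qed.

(** On the support of [u], [s * y j] is at least [s * y k], so replacing each [y j] by [y k] can
    only lower the sum. The factor [s] is 1 or -1 in the two uses. *)
Lemma compare_of_witness (u : 'rV[C]_n) (k l : 'I_n) (s : C) :
    u != 0 ->
    (forall j, u 0 j != 0 -> 0 <= s * (y j - y k)) ->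
    s * \sum_j (y j - x l) * `|u 0 j| ^+ 2 <= 0 ->
  s * (y k - x l) <= 0.
Proof.
move=> u0 yk le0; rewrite -(pmulr_lle0 _ (sum_sq_gt0 u0)).
apply: le_trans le0; rewrite !mulr_sumr; apply: ler_sum => j _.
have [->|uj] := eqVneq (u 0 j) 0; first by rewrite normr0 expr0n !mulr0.
rewrite mulrA ler_wpM2r ?exprn_ge0 // -subr_ge0 -mulrBr.
by rewrite opprB addrA subrK yk.
Qed.

Lemma interlace_below (k : 'I_n) : y k <= x k.
Proof.
(* [u] has no coordinate before [k] and its vector none strictly between [k] and the negative
   direction: [n - 1] conditions, with column [k] as padding. On such vectors the form shifted by
   [x k] is nonpositive. *)
pose A : 'M[C]_n := \matrix_(j, c)
  if (c < k)%N then (j == c)%:R else if c == k then 0 else p j c.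
have [|u u0 uA] := @kernel_of_zero_col A k.
  by move=> j; rewrite mxE ltnn eqxx.
have u_low (j : 'I_n) : (j < k)%N -> u 0 j = 0.
  move=> jk; rewrite -[RHS](uA j) (bigD1 j) //= mxE jk eqxx mulr1 big1 ?addr0 //.
  by move=> i /negPf ij; rewrite mxE jk ij mulr0.
have w_high (i : 'I_n) : (k < i)%N -> \sum_j u 0 j * p j i = 0.
  move=> ki; rewrite -[RHS](uA i); apply: eq_bigr => j _; rewrite mxE.
  by rewrite ltnNge ltnW //= -val_eqE gtn_eqF.
rewrite -subr_le0 -[_ - _]mul1r; apply: (compare_of_witness (u := u)) => //.
  move=> j uj; rewrite mul1r subr_ge0 y_mono // leqNgt.
  by apply: contra uj => /u_low->.
rewrite mul1r -(shifted_form (u 0)) subr_le0 (@le_trans _ _ 0) //.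
  apply: sumr_le0 => i _; have [ik|ki] := leqP i k.
    by rewrite mulr_le0_ge0 ?exprn_ge0 // subr_le0 x_mono.
  by rewrite w_high // normr0 expr0n mulr0.
by rewrite mulr_ge0 ?exprn_ge0 // subr_ge0.
Qed.

Lemma interlace_above (k l : 'I_n) : l = k.+1 :> nat -> x k <= y l.
Proof.
move=> lk.
(* The conditions kill the coordinates of [u] after [l], those of its vector before [k], and its
   negative component, stored in column [k]. As [l = k + 1], only column [l] is left as padding; the
   form shifted by [x k] is now nonnegative. *)
pose A : 'M[C]_n := \matrix_(j, c)
  if (l < c)%N then (j == c)%:R else if c == l then 0
  else if c == k then q j else p j c.
have [|u u0 uA] := @kernel_of_zero_col A l.
  by move=> j; rewrite mxE ltnn eqxx.
have kl : k == l = false by apply/eqP => /(congr1 val) /=; lia.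
have u_high (j : 'I_n) : (l < j)%N -> u 0 j = 0.
  move=> jk; rewrite -[RHS](uA j) (bigD1 j) //= mxE jk eqxx mulr1 big1 ?addr0 //.
  by move=> i /negPf ij; rewrite mxE jk ij mulr0.
have w_low (i : 'I_n) : (i < k)%N -> \sum_j u 0 j * p j i = 0.
  move=> ik; rewrite -[RHS](uA i); apply: eq_bigr => j _; rewrite mxE.
  rewrite ltnNge (_ : (i <= l)%N) /=; last by lia.
  by rewrite -!val_eqE /= !ltn_eqF //; lia.
have w_last : \sum_j u 0 j * q j = 0.
  rewrite -[RHS](uA k); apply: eq_bigr => j _; rewrite mxE.
  by rewrite ltnNge (_ : (k <= l)%N) /= ?kl ?eqxx //; lia.
rewrite -subr_le0 -opprB -mulN1r; apply: (compare_of_witness (u := u)) => //.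
  move=> j uj; rewrite mulN1r opprB subr_ge0 y_mono // leqNgt.
  by apply: contra uj => /u_high->.
rewrite mulN1r oppr_le0 -(shifted_form (u 0)) w_last normr0 expr0n mulr0 subr0.
apply: sumr_ge0 => i _; have [ki|ik] := leqP k i.
  by rewrite mulr_ge0 ?exprn_ge0 // subr_ge0 x_mono.
by rewrite w_low // normr0 expr0n mulr0.
Qed.

End MinMax.

(** * The Killing form of su(n,1) as a trace form *)

Local Open Scope complex_scope.
Local Open Scope sesquilinear_scope.

(* The family [u] only has to span: no linear independence is assumed. *)
Lemma lftrace_frame (R : realType) (V : vectType R) (I : finType)
    (u : I -> V) (phi : I -> {linear V -> R^o}) (f : 'End(V)) :
    (forall v, v = \sum_a phi a v *: u a) ->
  lftrace f = \sum_a phi a (f (u a)).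
Proof.
move=> frame; rewrite /lftrace; set b := vbasis _.
under [RHS]eq_bigr => a _.
  rewrite {1}(coord_vbasis (memvf (u a))) !linear_sum /=.
  under eq_bigr do rewrite !linearZ /=.
  over.
rewrite exchange_big; apply: eq_bigr => i _.
rewrite {1}(frame (f b`_i)) linear_sum; apply: eq_bigr => a _.
by rewrite linearZ /= mulrC.
Qed.

Section Killing.
Variables (R : realType) (n : nat).
Local Notation C := R[i].
Local Notation M := 'M[C]_(n + 1).
Local Notation J := (J R n).

Lemma J_diag : J = diag_mx (row_mx (const_mx 1) (const_mx (-1))).
Proof.
rewrite /Defs.J -[1%:M]diag_const_mx -(raddfN _ 1) /= -[(-1)%:M]diag_const_mx.
by rewrite -diag_mx_row.
Qed.

Lemma J_conj : J ^t* = J.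
Proof.
rewrite /Defs.J tr_block_mx map_block_mx !trmx0 !map_mx0 linearN /= map_mxN.
by rewrite !tr_scalar_mx !map_scalar_mx rmorph1.
Qed.

Lemma JJ : J *m J = 1%:M.
Proof.
rewrite /Defs.J mulmx_block !mulmx0 !mul0mx !addr0 !add0r mulmxN mulNmx opprK.
by rewrite !mulmx1 -scalar_mx_block.
Qed.

(** The projection of complex matrices onto u(n,1), the fixed points of the involution sending [A]
    to [- J A^* J]. Removing the trace then lands in su(n,1). *)
Definition skew_part (A : M) : M := 2^-1 *: (A - J *m A ^t* *m J).

Definition su_proj (A : cmx R (n + 1)) : su R n :=
  to_su (skew_part A - (\tr (skew_part A) / (n + 1)%:R)%:M).

Lemma skew_part_linear (a : R) (A B : M) :
  skew_part (a%:C *: A + B) = a%:C *: skew_part A + skew_part B.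
Proof.
rewrite /skew_part; have -> : (a%:C *: A + B) ^t* = a%:C *: A ^t* + B ^t*.
  apply/matrixP => i j; rewrite !mxE rmorphD rmorphM /=.
  by rewrite -[Num.conj _]/(conjc _) conjc_real.
rewrite mulmxDr mulmxDl -scalemxAr -scalemxAl opprD addrACA -scalerBr.
by rewrite scalerDr !scalerA mulrC.
Qed.

Fact su_proj_linear : linear su_proj.
Proof.
move=> a A B; rewrite /su_proj cmx_scaleE skew_part_linear -to_su_linear.
congr to_su; rewrite mxtraceD mxtraceZ mulrDl raddfD /= -mulrA.
by rewrite -scale_scalar_mx scalerBr opprD addrACA.
Qed.
HB.instance Definition _ :=
  GRing.isLinear.Build R _ _ _ su_proj su_proj_linear.

Lemma skew_partJ (A : M) : (skew_part A) ^t* *m J + J *m skew_part A = 0.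
Proof.
have conj2 : Num.conj (2^-1 : C) = 2^-1 by rewrite fmorphV rmorph_nat.
have -> : (skew_part A) ^t* = 2^-1 *: (A ^t* - J *m A *m J).
  rewrite /skew_part linearZ /= map_mxZ /= conj2 linearB /= map_mxB.
  have AK : A ^t* ^t* = A by apply/matrixP => i j; rewrite !mxE conjCK.
  by rewrite !trmx_mul !map_mxM J_conj -mulmxA /= AK.
rewrite /skew_part -scalemxAl -scalemxAr -scalerDr mulmxBl mulmxBr.
by rewrite -!mulmxA JJ mulmx1 !mulmxA JJ mul1mx addrA subrK subrr scaler0.
Qed.

Lemma trace_J_skew (A : M) :
  A ^t* *m J + J *m A = 0 -> Num.conj (\tr A) = - \tr A.
Proof.
move/eqP; rewrite addr_eq0 => /eqP E.
rewrite -trace_map_mx -mxtrace_tr map_trmx -[in LHS](mulmx1 (A ^t*)).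
have -> : A ^t* *m 1%:M = A ^t* *m J *m J by rewrite -mulmxA JJ.
by rewrite E mulNmx raddfN /= mxtrace_mulC mulmxA JJ mul1mx.
Qed.

Lemma su_proj_mx (A : M) :
  su_mx (su_proj A) = skew_part A - (\tr (skew_part A) / (n + 1)%:R)%:M.
Proof.
(* The trace of a [J]-skew matrix is imaginary, so the scalar matrix removed is itself [J]-skew. *)
set t := _ / _; have ct : Num.conj t = - t.
  by rewrite /t rmorphM /= trace_J_skew ?skew_partJ // fmorphV rmorph_nat mulNr.
rewrite to_suK // mem_su; apply/andP; split; last first.
  rewrite raddfB /= mxtrace_scalar -[t *+ _]mulr_natr divfK ?subrr //.
  by rewrite pnatr_eq0 addn1.
rewrite linearB /= map_mxB tr_scalar_mx map_scalar_mx /= ct.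
rewrite mulmxBl mulmxBr addrACA skew_partJ add0r raddfN /= mulNmx opprK.
by rewrite mul_scalar_mx mul_mx_scalar subrr.
Qed.

Lemma su_proj_id (X : su R n) : su_proj (su_mx X) = X.
Proof.
have [/eqP + tX] := su_mxP X; rewrite addr_eq0 => /eqP hX.
have E : skew_part (su_mx X) = su_mx X.
  rewrite /skew_part -mulmxA hX mulmxN opprK mulmxA JJ mul1mx.
  by rewrite scalerDr -scalerDl (_ : 2^-1 + 2^-1 = 1 :> C) ?scale1r //; field.
apply: val_inj; rewrite /= -[RHS]/(su_mx X) -[LHS]/(su_mx _) su_proj_mx E tX.
by rewrite mul0r raddf0 subr0.
Qed.

Definition re_entry (p q : 'I_(n + 1)) (X : su R n) : R^o :=
  complex.Re (su_mx X p q).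
Definition im_entry (p q : 'I_(n + 1)) (X : su R n) : R^o :=
  complex.Im (su_mx X p q).

Fact re_entry_linear p q : linear (re_entry p q).
Proof.
move=> a X Y; rewrite /re_entry su_mx_linear !mxE /=.
by case: (su_mx X _ _) (su_mx Y _ _) => [? ?] [? ?] /=; rewrite mul0r subr0.
Qed.
HB.instance Definition _ p q :=
  GRing.isLinear.Build R _ _ _ (re_entry p q) (re_entry_linear p q).

Fact im_entry_linear p q : linear (im_entry p q).
Proof.
move=> a X Y; rewrite /im_entry su_mx_linear !mxE /=.
by case: (su_mx X _ _) (su_mx Y _ _) => [? ?] [? ?] /=; rewrite mul0r addr0.
Qed.
HB.instance Definition _ p q :=
  GRing.isLinear.Build R _ _ _ (im_entry p q) (im_entry_linear p q).

Let index := ('I_(n + 1) * 'I_(n + 1) * bool)%type.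
Let unit_mx (a : index) : M :=
  (if a.2 then 'i else 1) *: delta_mx a.1.1 a.1.2.
(** Projections of [E_pq] and [i E_pq], with the real and imaginary parts of the entries as
    coefficients: a redundant but spanning family, as [lftrace_frame] allows. *)
Let frame (a : index) : su R n := su_proj (unit_mx a).
Let coframe (a : index) : {linear su R n -> R^o} :=
  if a.2 then im_entry a.1.1 a.1.2 : {linear su R n -> R^o}
  else re_entry a.1.1 a.1.2.

Let frameP X : X = \sum_a coframe a X *: frame a.
Proof.
rewrite -{1}(su_proj_id X); under eq_bigr do rewrite -linearZ /=.
rewrite -linear_sum /=; congr su_proj.
rewrite -(pair_bigA _ (fun pq b => coframe (pq, b) X *:
  (unit_mx (pq, b) : cmx R _))) /=.
rewrite -(pair_bigA _ (fun p q => \sum_b coframe (p, q, b) X *: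
  (unit_mx (p, q, b) : cmx R _))) /=.
rewrite [LHS]matrix_sum_delta; apply: eq_bigr => p _; apply: eq_bigr => q _.
rewrite big_bool /= !cmx_scaleE /unit_mx /coframe /= !scalerA.
apply: etrans (scalerDl (delta_mx p q : M) _ _); congr (_ *: _).
rewrite /re_entry /im_entry; case: (su_mx X p q) => [u v] /=.
by apply/eqP; rewrite eq_complex /=; apply/andP; split; apply/eqP; ring.
Qed.

(* As scalars commute with X and Y, and [F := ad X o ad Y] is complex linear,
   the two real frame vectors over the entry (p, q) contribute together the real
   part of the (p, q) entry of F(E_pq). *)
Lemma killingE (X Y : su R n) :
  killing X Y = 2 * (n + 1)%:R * complex.Re (\tr (su_mx X *m su_mx Y)).
Proof.
rewrite /killing (lftrace_frame _ frameP).
set x := su_mx X; set y := su_mx Y.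
pose F (B : M) : M := x *m (y *m B - B *m y) - (y *m B - B *m y) *m x.
have br_lin (u : M) a (A B : M) : u *m (a *: A + B) - (a *: A + B) *m u =
    a *: (u *m A - A *m u) + (u *m B - B *m u).
  by rewrite mulmxDl mulmxDr -scalemxAl -scalemxAr scalerBr opprD addrACA.
have F_lin a (A B : M) : F (a *: A + B) = a *: F A + F B.
  by rewrite /F !br_lin.
have F_scalar a : F a%:M = 0.
  by rewrite /F mul_scalar_mx mul_mx_scalar subrr mulmx0 mul0mx subrr.
(* [su_proj] differs from [skew_part] by a scalar matrix, which [F] annihilates. *)
have adE (A : M) : su_mx ((ad X \o ad Y)%VF (su_proj A)) = F (skew_part A).
  rewrite comp_lfunE !ad_mx su_proj_mx -/x -/y.
  rewrite -[LHS]/(F _) addrC -scaleN1r F_lin F_scalar scaler0 add0r //.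
(* The complex trace of [F] on all matrices is [2 (n+1) tr(xy) - 2 tr(x) tr(y)], and [x], [y] are
   traceless. *)
have trF : \sum_p \sum_q F (delta_mx p q) p q = 2 * (n + 1)%:R * \tr (x *m y).
  have [_ tx] := su_mxP X; have [_ ty] := su_mxP Y.
  have deltaE (A B : M) p q : (A *m delta_mx p q *m B) p q = A p p * B q q.
    rewrite -(mul_delta_mx (0 : 'I_1)) mulmxA -colE -mulmxA -rowE mxE big_ord1.
    by rewrite !mxE.
  have FE p q : F (delta_mx p q) p q =
      (x *m y) p p - x p p * y q q - (y p p * x q q - (y *m x) q q).
    rewrite -!deltaE; have := deltaE (x *m y) 1%:M p q.
    rewrite mulmx1 [1%:M _ _]mxE eqxx mulr1 => <-.
    have := deltaE 1%:M (y *m x) p q; rewrite mul1mx [1%:M _ _]mxE eqxx mul1r => <-.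
    by rewrite /F mulmxBr mulmxBl !mulmxA !mxE.
  transitivity ((n + 1)%:R * \tr (x *m y) - \tr x * \tr y
    - (\tr y * \tr x - (n + 1)%:R * \tr (y *m x))).
    rewrite (eq_bigr (fun p => (x *m y) p p *+ (n + 1) - x p p * \tr y
      - (y p p * \tr x - \tr (y *m x)))) => [|p _].
      by rewrite !sumrB -!mulr_suml sumrMnl sumr_const card_ord !mulr_natl.
    rewrite (eq_bigr _ (fun q _ => FE p q)) !sumrB -!mulr_sumr sumr_const.
    by rewrite card_ord.
  rewrite tx ty [\tr (y *m x)]mxtrace_mulC; ring.
have F0 : F 0 = 0 by rewrite /F !(mulmx0, mul0mx, subr0).
clearbody F.
pose d : 'rV[C]_(n + 1) := row_mx (const_mx 1) (const_mx (-1)).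
have hermE (c : C) p q : skew_part (c *: delta_mx p q) =
    2^-1 *: (c *: delta_mx p q + (- Num.conj c * (d 0 q * d 0 p)) *: delta_mx q p).
  rewrite /skew_part linearZ /= map_mxZ /= trmx_delta map_delta_mx.
  rewrite -scalemxAr -scalemxAl J_diag -/d mulNr scaleNr -scalerA.
  congr (_ *: (_ - _ *: _)).
  apply/matrixP => i j; rewrite mul_mx_diag mul_diag_mx !mxE.
  have [->|] := eqVneq i q; have [->|] := eqVneq j p; rewrite /= ?(mulr0, mul0r) //.
  by ring.
(* The [E_qp] components of the two projected units contribute opposite real numbers; only the
   halves along [E_pq] add up. *)
have F_entry p q : complex.Im (F (skew_part ('i *: delta_mx p q)) p q) +
    complex.Re (F (skew_part (1 *: delta_mx p q)) p q) =
    complex.Re (F (delta_mx p q) p q).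
  have FZ a A : F (a *: A) = a *: F A by rewrite -[a *: A]addr0 F_lin F0 addr0.
  rewrite !hermE.
  rewrite !FZ.
  rewrite !F_lin.
  rewrite !FZ.
  have zE a (A : M) : (a *: A) p q = a * A p q by rewrite mxE.
  have dE (A B : M) : (A + B) p q = A p q + B p q by rewrite mxE.
  rewrite !(zE, dE) -!mulrA.
  move: (d 0 q * (d 0 p * _)) => w; move: (F _ p q) => e.
  have -> : Num.conj ('i : C) = - 'i by apply/eqP; rewrite eq_complex /= oppr0 !eqxx.
  have -> : (2^-1 : C) = (2^-1)%:C by rewrite fmorphV rmorph_nat.
  by rewrite rmorph1; case: w e => [? ?] [? ?] /=; field.
have imE p q Z : coframe (p, q, true) Z = complex.Im (su_mx Z p q) by [].
have reE p q Z : coframe (p, q, false) Z = complex.Re (su_mx Z p q) by [].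
have frT p q : frame (p, q, true) = su_proj ('i *: delta_mx p q) by [].
have frF p q : frame (p, q, false) = su_proj (1 *: delta_mx p q) by [].
transitivity (\sum_p \sum_q complex.Re (F (delta_mx p q) p q)).
  rewrite -(pair_bigA _ (fun pq b => coframe (pq, b)
    ((ad X \o ad Y)%VF (frame (pq, b))))).
  rewrite -(pair_bigA _ (fun p q => \sum_b coframe (p, q, b)
    ((ad X \o ad Y)%VF (frame (p, q, b))))).
  apply: eq_bigr => p _; apply: eq_bigr => q _; rewrite big_bool.
  rewrite (imE p q) (reE p q) (frT p q) (frF p q) -F_entry.
  congr (complex.Im _ + complex.Re _).
    exact: (congr1 (fun A : M => A p q) (adE ('i *: delta_mx p q))).
  exact: (congr1 (fun A : M => A p q) (adE (1 *: delta_mx p q))).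
have -> : \sum_p \sum_q complex.Re (F (delta_mx p q) p q) =
    complex.Re (\sum_p \sum_q F (delta_mx p q) p q).
  by rewrite raddf_sum; apply: eq_bigr => p _; rewrite raddf_sum.
rewrite trF; move: (\tr _) => t.
have -> : (2 * (n + 1)%:R : C) = (2 * (n + 1)%:R)%:C by rewrite rmorphM !rmorph_nat.
by case: t => u v /=; rewrite mul0r subr0.
Qed.

End Killing.

(** * Coordinates on the torus and duality through the Killing form *)

Section Torus.
Variables (R : realType) (n : nat).
Local Notation C := R[i].
Local Notation M := 'M[C]_(n + 1).
Local Notation J := (J R n).
Local Notation N := (n + 1)%:R.

Definition tor_of (h : 'rV[R]_n) : tor R n :=
  vsproj (t_space R n) (u_to_su (idiag h)).

Lemma tor_ofK h : vsval (tor_of h) = u_to_su (idiag h).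
Proof.
by rewrite vsprojK //; apply/memv_imgP; exists h; rewrite ?memvf // lfunE.
Qed.

Lemma tor_ofP (H : tor R n) : exists h, H = tor_of h.
Proof.
have /memv_imgP[h _ E] := subvsP H; exists h; apply: subvs_inj.
by rewrite tor_ofK; move: E; rewrite lfunE.
Qed.

Fact tor_of_linear : linear tor_of.
Proof. by move=> a h h'; rewrite /tor_of !linearP. Qed.
HB.instance Definition _ := GRing.isLinear.Build R _ _ _ tor_of tor_of_linear.

Lemma tor_of_sum h : tor_of h = \sum_j h 0 j *: e_t R j.
Proof.
by rewrite {1}(row_sum_delta h) linear_sum; apply: eq_bigr => j _; rewrite linearZ.
Qed.

Definition tor_diag (h : 'rV[R]_n) : 'rV[C]_(n + 1) :=
  map_mx (real_complex R) (row_mx h (const_mx (- \sum_j h 0 j))).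

Lemma tor_diagl h j : tor_diag h 0 (lshift 1 j) = (h 0 j)%:C.
Proof. by rewrite mxE row_mxEl. Qed.

Lemma tor_diagr h j : tor_diag h 0 (rshift n j) = (- \sum_j h 0 j)%:C.
Proof. by rewrite mxE row_mxEr mxE. Qed.

Lemma tor_of_mx h : su_mx (vsval (tor_of h)) = 'i *: diag_mx (tor_diag h).
Proof.
rewrite tor_ofK u_to_su_mx ?mem_u_idiag // /tor_diag map_row_mx diag_mx_row.
rewrite scale_block_mx !scaler0 map_const_mx diag_const_mx scale_scalar_mx.
congr block_mx; congr (_%:M); rewrite rmorphN mulrN /idiag mxtraceZ mxtrace_diag.
by rewrite rmorph_sum; congr (- (_ * _)); apply: eq_bigr => j _; rewrite mxE.
Qed.

Lemma killing_of_mx (X Y : su R n) (A B : M) : su_mx X = A -> su_mx Y = B ->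
  killing X Y = 2 * N * complex.Re (\tr (A *m B)).
Proof. by move=> <- <-; apply: killingE. Qed.

Lemma killing_tor h h' : killing (vsval (tor_of h)) (vsval (tor_of h')) =
  - (2 * N) * (\sum_j h 0 j * h' 0 j + (\sum_j h 0 j) * (\sum_j h' 0 j)).
Proof.
rewrite (killing_of_mx (tor_of_mx h) (tor_of_mx h')).
rewrite -scalemxAl -scalemxAr mulmx_diag !mxtraceZ mxtrace_diag.
rewrite (eq_bigr (fun i => tor_diag h 0 i * tor_diag h' 0 i)) => [|i _]; last first.
  by rewrite [LHS]mxE.
rewrite big_split_ord big_ord1 /= !tor_diagr.
rewrite (eq_bigr (fun j => (h 0 j * h' 0 j)%:C)) => [|j _]; last first.
  by rewrite !tor_diagl rmorphM.
by rewrite -rmorph_sum /=; ring.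
Qed.

Lemma dual_tor (xi : dualsp (tor R n)) h :
  xi (tor_of h) = \sum_j h 0 j * pairing (e_t R j) xi.
Proof.
by rewrite tor_of_sum linear_sum; apply: eq_bigr => j _; rewrite linearZ.
Qed.

Lemma killing_sharp (xi : dualsp (tor R n)) (H : tor R n) :
  killing (vsval (sharp xi)) (vsval H) = xi H.
Proof.
(* [sharp] is a generalized inverse of [flat], hence a true preimage once [xi] lies in the image of
   [flat]. *)
suff [H0 E] : exists H0, flat R n H0 = xi.
  have : flat R n (sharp xi) = xi.
    by rewrite /sharp limg_lfunVK // -E memv_img ?memvf.
  move/lfunP/(_ H) => <-.
  by rewrite lfunE /= /flat_fun /restr comp_lfunE !lfunE.
pose s := \sum_j pairing (e_t R j) xi.
(* Solves [- 2 (n+1) (h_j + sum h) = xi_j]; summing over [j] gives [sum h = - s / (2 (n+1)^2)]. *)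
exists (tor_of (\row_j (- (2 * N)^-1 * (pairing (e_t R j) xi - s / N)))).
apply/lfunP => H'; have [h ->] := tor_ofP H'.
rewrite lfunE /= /flat_fun /restr comp_lfunE !lfunE /= killing_tor dual_tor.
have N0 : N != 0 :> R by rewrite pnatr_eq0 addn1.
under eq_bigr do rewrite mxE.
under [X in _ + X * _]eq_bigr do rewrite mxE.
rewrite -[X in _ + X * _]mulr_sumr sumrB -/s sumr_const card_ord.
rewrite mulr_sumr -big_split mulr_sumr /=; apply: eq_bigr => j _.
rewrite -[s / N *+ n]mulr_natr.
have -> : n%:R = N - 1 :> R by rewrite natrD addrK.
by move: ((n + 1)%:R) N0 => c c0; field.
Qed.

Lemma sharp_coord (xi : dualsp (tor R n)) (y : 'rV[R]_n) j :
  sharp xi = tor_of y -> pairing (e_t R j) xi = - (2 * N) * (y 0 j + \sum_i y 0 i).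
Proof.
move=> E; rewrite /pairing -killing_sharp E killing_tor.
rewrite [X in _ + _ * X](bigD1 j) //= [X in _ + _ * (_ + X)]big1; last first.
  by move=> i /negPf ij; rewrite mxE ij andbF.
rewrite (bigD1 j) //= big1 => [|i /negPf ij]; last by rewrite mxE ij andbF mulr0.
by rewrite mxE !eqxx !addr0 !mulr1.
Qed.

(** In [lambda_t] the subtracted sum removes the term [\sum_i y 0 i] common to all coordinates of
    [xi]. The factor left is negative, so inequalities are reversed. *)
Lemma pairing_lambda (xi : dualsp (tor R n)) (y : 'rV[R]_n) k :
  sharp xi = tor_of y -> pairing (lambda_t R k) xi = - (2 * N ^+ 2) * y 0 k.
Proof.
move=> E.
transitivity (n.+1%:R * pairing (e_t R k) xi - \sum_j pairing (e_t R j) xi).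
  by rewrite /pairing linearB linearZ linear_sum.
rewrite (eq_bigr _ (fun j _ => sharp_coord j E)) (sharp_coord k E).
rewrite -mulr_sumr big_split /=.
rewrite sumr_const card_ord -[_ *+ n]mulr_natr -addn1.
have -> : n%:R = N - 1 :> R by rewrite natrD addrK.
ring.
Qed.

Lemma chamber_coord (xi : dualsp (tor R n)) (y : 'rV[R]_n) :
  sharp xi = tor_of y ->
  chamber xi <-> forall i j : 'I_n, (i <= j)%N -> y 0 i <= y 0 j.
Proof.
move=> E; have N0 : - (2 * N) < 0 :> R.
  by rewrite oppr_lt0 mulr_gt0 ?ltr0n // addn1.
have le_coord i j :
    (pairing (e_t R j) xi <= pairing (e_t R i) xi) = (y 0 i <= y 0 j).
  apply: etrans (congr2 (fun u v : R => u <= v)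
    (sharp_coord j E) (sharp_coord i E)) _.
  by rewrite ler_nM2l // lerD2r.
by split=> H i j /H; rewrite le_coord.
Qed.

(** Positivity for all [k] thus says that every [y 0 k] lies below [- \sum_i y 0 i], the last entry
    of [tor_diag y]. *)
Lemma inner_beta (xi : dualsp (tor R n)) (y : 'rV[R]_n) k :
  sharp xi = tor_of y ->
  inner_t (beta R k) xi = - (y 0 k + \sum_i y 0 i).
Proof.
move=> E; rewrite /inner_t killing_sharp E /beta add_lfunE sum_lfunE.
by rewrite estar_idiag; congr (- (_ + _)); apply: eq_bigr => i _;
  rewrite estar_idiag.
Qed.

Lemma su_mx_ur (V : su R n) (X := su_mx V) :
  (ulsubmx X) ^t* = - ulsubmx X /\ drsubmx X = (- \tr (ulsubmx X))%:M.
Proof.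
have [/eqP + t0] := su_mxP V; rewrite -/X addr_eq0 => /eqP hX; split.
  have /(congr1 ulsubmx) := hX.
  rewrite -{1 2}(submxK X) /Defs.J tr_block_mx map_block_mx.
  rewrite !mulmx_block !(mulmx0, mul0mx, mulmx1, mul1mx, addr0, add0r).
  by rewrite opp_block_mx !block_mxKul.
have := t0; rewrite -/X -{1}(submxK X) mxtrace_block => /eqP.
rewrite addrC addr_eq0 => /eqP E; rewrite -E.
by apply/matrixP => i j; rewrite !ord1 [in RHS]mxE /mxtrace big_ord1.
Qed.

(* The block A = W itself is the witness: [killing V (u_to_su W)] is a negative
   multiple of the sum of the |W_ij|^2 and |tr W|^2. *)
Lemma killing_k_eq0 (V : su R n) :
  (forall A : cmx R n, A \in u_space R n -> killing V (u_to_su A) = 0) <->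
  ulsubmx (su_mx V) = 0.
Proof.
have [hW dW] := su_mx_ur V; set W := ulsubmx _ in hW dW *.
have trE (A : 'M[C]_n) : (A : cmx R n) \in u_space R n ->
    killing V (u_to_su (A : cmx R n)) =
      2 * N * complex.Re (\tr (W *m A) + \tr W * \tr A).
  move=> Au; rewrite (killing_of_mx erefl (u_to_su_mx Au)).
  rewrite -[su_mx V]submxK dW mulmx_block !mulmx0 !add0r addr0 mxtrace_block.
  by rewrite mul_scalar_mx scale_scalar_mx mxtrace_scalar mulrNN.
split=> [H|W0 A Au]; last by rewrite trE // W0 mul0mx mxtrace0 mul0r addr0 mulr0.
have Wu : (W : cmx R n) \in u_space R n.
  by rewrite mem_u hW addNr.
have N0 : 2 * N != 0 :> R by rewrite mulf_neq0 ?pnatr_eq0 ?addn1.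
have := H _ Wu; rewrite trE // => /eqP; rewrite mulf_eq0 (negPf N0) /=.
have conj_tr : Num.conj (\tr W) = - \tr W.
  by rewrite -[in LHS]mxtrace_tr -trace_map_mx hW raddfN.
have -> : \tr (W *m W) + \tr W * \tr W =
    - (\sum_i \sum_j `|W i j| ^+ 2 + `|\tr W| ^+ 2).
  rewrite normCK conj_tr mulrN opprD opprK; congr (_ + _).
  rewrite /mxtrace -sumrN; apply: eq_bigr => i _.
  rewrite mxE -sumrN; apply: eq_bigr => j _.
  rewrite normCK -mulrN; congr (_ * _).
  by have /matrixP/(_ j i) := hW; rewrite !mxE => ->; rewrite opprK.
set T := _ + _ => /eqP ReT.
have T0 : 0 <= T.
  rewrite addr_ge0 ?exprn_ge0 // sumr_ge0 // => i _.
  by rewrite sumr_ge0 // => j _; rewrite exprn_ge0.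
(* [0 <= T] in [R[i]] includes that [T] is real, so a vanishing real part suffices. *)
have {ReT} : T = 0.
  move: T0 ReT; case: (T) => u v; rewrite lecE /= => /andP[/eqP-> _] /eqP.
  by rewrite oppr_eq0 => /eqP->.
move/eqP; rewrite paddr_eq0 ?exprn_ge0 //; last first.
  by rewrite sumr_ge0 // => i _; rewrite sumr_ge0 // => j _; rewrite exprn_ge0.
case/andP => /eqP S0 _; apply/matrixP => i j; rewrite [RHS]mxE; apply/eqP.
rewrite -normr_eq0 -sqrf_eq0.
have := psumr_eq0P _ S0 => /(_ _ i isT) Si.
have := psumr_eq0P _ (Si _) => /(_ _ _ j isT) -> //.
  by move=> l _; rewrite exprn_ge0.
by move=> l _; rewrite sumr_ge0 // => m _; rewrite exprn_ge0.
Qed.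

End Torus.

(** * The orbit projection as a matrix problem in SU(n,1) *)

Section Orbit.
Variables (R : realType) (n : nat).
Local Notation C := R[i].
Local Notation M := 'M[C]_(n + 1).
Local Notation J := (J R n).

Lemma SU_unit (g : M) : SU g -> g \in unitmx.
Proof. by case=> _ dg; rewrite unitmxE dg unitr1. Qed.

Lemma SU_inv (g : M) : SU g -> invmx g = J *m g ^t* *m J.
Proof.
move=> sg; have gU := SU_unit sg; case: sg => gJ _.
have E : J *m g ^t* *m J *m g = 1%:M by rewrite -!mulmxA [g ^t* *m _]mulmxA gJ JJ.
by rewrite -[RHS](mulmxK gU) E mul1mx.
Qed.

Lemma SU_row (g : M) : SU g -> g *m J *m g ^t* = J.
Proof.
move=> sg; have := mulmxV (SU_unit sg); rewrite (SU_inv sg).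
by rewrite !mulmxA => /(congr1 (mulmx^~ J)) /=;
  rewrite -[LHS]mulmxA JJ mulmx1 mul1mx.
Qed.

Lemma SU_of_row (g : M) : g *m J *m g ^t* = J -> \det g = 1 -> SU g.
Proof.
move=> gJ dg; split=> //.
have : (g *m (J *m g ^t* *m J)) = 1%:M by rewrite !mulmxA gJ JJ.
move/mulmx1C => /(congr1 (mulmx J)).
by rewrite !mulmxA JJ mul1mx mulmx1.
Qed.

Lemma SU_invmx (g : M) : SU g -> SU (invmx g).
Proof.
move=> sg; have gU := SU_unit sg; case: (sg) => gJ dg; split; last first.
  by rewrite det_inv dg invr1.
have gtU : g ^t* \in unitmx by rewrite map_unitmx unitmx_tr.
have it : (invmx g) ^t* = invmx (g ^t*) by rewrite trmx_inv map_invmx.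
by rewrite it -[J in LHS]gJ !mulmxA mulVmx // mul1mx mulmxK.
Qed.

Lemma killing_Ad (g : M) (X Y : su R n) :
  SU g -> killing X (Ad (invmx g) Y) = killing (Ad g X) Y.
Proof.
move=> sg.
rewrite (killing_of_mx erefl (Ad_mx Y (SU_invmx sg))).
rewrite (killing_of_mx (Ad_mx X sg) erefl) invmxK; congr (_ * complex.Re _).
by rewrite mulmxA mxtrace_mulC !mulmxA.
Qed.

(** Invariance of the Killing form moves [g] onto [sharp L]; the functionals agree on k exactly when
    the difference of their Killing duals is orthogonal to k, which [killing_k_eq0] reads off the
    upper-left block. *)
Lemma coadjoint_orbit_projection (L xi : dualsp (tor R n)) (g : M) : SU g ->
  Phi_K (coadjoint g (t_to_g L)) = t_to_k xi <->
  ulsubmx (su_mx (Ad g (vsval (sharp L)) - vsval (sharp xi))) = 0.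
Proof.
move=> sg; rewrite -killing_k_eq0.
have lhsE Z : Phi_K (coadjoint g (t_to_g L)) Z =
    killing (Ad g (vsval (sharp L))) (vsval Z).
  rewrite -killing_Ad // /Phi_K /coadjoint /restr /t_to_g /killing_form.
  by rewrite !(comp_lfunE, lfunE).
have rhsE Z : t_to_k xi Z = killing (vsval (sharp xi)) (vsval Z).
  by rewrite /t_to_k /restr /t_to_g /killing_form comp_lfunE !lfunE.
have subE X Y Z : killing (X - Y) Z = killing X Z - killing Y Z :> R.
  by rewrite !(killingC _ Z) linearB.
split=> [/lfunP H A Au|H].
  have kA : u_to_su A \in k_space R n.
    by apply/memv_imgP; exists A => //; rewrite lfunE.
  have := H (vsproj _ (u_to_su A)); rewrite lhsE rhsE vsprojK // => E.
  by rewrite subE E subrr.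
apply/lfunP => Z; rewrite lhsE rhsE.
have /memv_imgP[A Au ZA] := subvsP Z.
have {}ZA : vsval Z = u_to_su A by rewrite ZA lfunE.
by have := H A Au; rewrite subE -ZA => /eqP; rewrite subr_eq0 => /eqP.
Qed.

Lemma Delta_KE (L xi : dualsp (tor R n)) (x y : 'rV[R]_n) :
    sharp L = tor_of x -> sharp xi = tor_of y ->
  Delta_K L xi <-> chamber xi /\ exists2 g : M, SU g &
    ulsubmx (g *m diag_mx (tor_diag x) *m invmx g) =
      diag_mx (map_mx (real_complex R) y).
Proof.
move=> Lx xiy.
have keyXY (g : M) (X Y : su R n) (D D' : M) : SU g ->
    su_mx X = 'i *: D -> su_mx Y = 'i *: D' ->
    ulsubmx (su_mx (Ad g X - Y)) = 'i *: (ulsubmx (g *m D *m invmx g) - ulsubmx D').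
  move=> sg XD YD; have -> : su_mx (Ad g X - Y) = su_mx (Ad g X) - su_mx Y.
    by rewrite /su_mx linearB.
  rewrite Ad_mx // XD YD -scalemxAr -scalemxAl -scalerBr.
  by apply/matrixP => i j; rewrite !mxE.
have key (g : M) : SU g ->
    ulsubmx (su_mx (Ad g (vsval (sharp L)) - vsval (sharp xi))) = 'i *:
    (ulsubmx (g *m diag_mx (tor_diag x) *m invmx g) -
      diag_mx (map_mx (real_complex R) y)).
  move=> sg; rewrite Lx xiy (keyXY _ _ _ _ _ sg (tor_of_mx x) (tor_of_mx y)).
  by rewrite {2}/tor_diag map_row_mx diag_mx_row block_mxKul.
have i0 : ('i : C) != 0 by rewrite eq_complex /= oner_eq0 andbF.
split=> [[ch [f [g sg <-]]]|[ch [g sg E]]].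
  move/(coadjoint_orbit_projection _ _ sg); rewrite key // => /eqP.
  rewrite scaler_eq0 (negPf i0) subr_eq0 => /eqP E.
  by split=> //; exists g.
split=> //; exists (coadjoint g (t_to_g L)); first by exists g.
by apply/(coadjoint_orbit_projection _ _ sg); rewrite key // E subrr scaler0.
Qed.

(** The inverse is [J g^* J]: the inner [J] puts the minus sign on the last term, and the outer one
    acts as 1 on the upper-left block. *)
Lemma conj_block_entry (g : M) (d : 'rV[C]_(n + 1)) j k : SU g ->
  ulsubmx (g *m diag_mx d *m invmx g) j k =
  \sum_i d 0 (lshift 1 i) *
     (g (lshift 1 j) (lshift 1 i) * Num.conj (g (lshift 1 k) (lshift 1 i)))
  - d 0 (rshift n 0) *
     (g (lshift 1 j) (rshift n 0) * Num.conj (g (lshift 1 k) (rshift n 0))).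
Proof.
move=> sg; transitivity ((g *m diag_mx d *m invmx g) (lshift 1 j) (lshift 1 k)).
  by rewrite 2!mxE.
rewrite SU_inv // J_diag !mulmxA; set e := row_mx _ _.
have el i : e 0 (lshift 1 i) = 1 by rewrite row_mxEl mxE.
have er i : e 0 (rshift n i) = -1 by rewrite row_mxEr mxE.
rewrite !mul_mx_diag [LHS]mxE el mulr1 [LHS]mxE.
rewrite big_split_ord big_ord1 /=; congr (_ + _).
  apply: eq_bigr => i _; rewrite mxE [X in X * _ * _]mxE el.
  by rewrite [X in _ * X]mxE [g^T _ _]mxE; ring.
rewrite mxE [X in X * _ * _]mxE er.
by rewrite [X in _ * X]mxE [g^T _ _]mxE; ring.
Qed.

Let opt (i : 'I_(n + 1)) : option 'I_n := if split i is inl j then Some j else None.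

Let opt_l j : opt (lshift 1 j) = Some j.
Proof. by rewrite /opt (unsplitK (inl j)). Qed.

Let opt_r j : opt (rshift n j) = None.
Proof. by rewrite /opt (unsplitK (inr j)). Qed.

Let sum_opt (f : option 'I_n -> R) : \sum_i f (opt i) = \sum_t f t.
Proof.
rewrite big_split_ord big_ord1 /= opt_r big_option /= addrC; congr (_ + _).
by apply: eq_bigr => i _; rewrite opt_l.
Qed.

Let opt_inj : injective opt.
Proof.
move=> i j; rewrite -(splitK i) -(splitK j).
case: (split i) => i'; case: (split j) => j' /=; rewrite ?opt_l ?opt_r //.
  by case=> ->.
by rewrite !ord1.
Qed.

(** Only the rows [Some j] are reproduced: the upper-left block of a conjugate involves no other, so
    the last row is available to adjust the determinant. *)
Lemma SU_of_pseudo_orthogonal (g : option 'I_n -> option 'I_n -> R) :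
    (forall s s', \sum_t lorentz_sign R t * (g s t * g s' t) =
      lorentz_sign R s *+ (s == s')) ->
  exists2 G : M, SU G &
    (forall j i, G (lshift 1 j) (lshift 1 i) = (g (Some j) (Some i))%:C) /\
    (forall j, G (lshift 1 j) (rshift n 0) = (g (Some j) None)%:C).
Proof.
move=> gJ; pose G0 : 'M[R]_(n + 1) := \matrix_(i, k) g (opt i) (opt k).
pose d := \det G0.
(* Rescaling the last row by d = det g = +-1 normalizes the determinant. *)
pose h s t := (if s is Some _ then 1 else d) * g s t.
pose G : 'M[R]_(n + 1) := \matrix_(i, k) h (opt i) (opt k).
pose Jr : 'M[R]_(n + 1) := diag_mx (\row_i lorentz_sign R (opt i)).
have mxJ (f : option 'I_n -> option 'I_n -> R)
    (A := \matrix_(i, k) f (opt i) (opt k)) :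
    (forall s s', \sum_t lorentz_sign R t * (f s t * f s' t) =
      lorentz_sign R s *+ (s == s')) ->
    A *m Jr *m A^T = Jr.
  move=> fJ; apply/matrixP => i k; rewrite mul_mx_diag !mxE.
  rewrite -(inj_eq opt_inj) -fJ -sum_opt; apply: eq_bigr => l _.
  by rewrite !mxE; ring.
have Jr0 : \det Jr != 0.
  rewrite det_diag; apply/prodf_neq0 => i _; rewrite mxE.
  by case: (opt i) => [?|] /=; rewrite ?oppr_eq0 oner_eq0.
have dd : d * d = 1.
  have /(congr1 determinant) := mxJ g gJ; rewrite !det_mulmx det_tr -/G0 -/d.
  by rewrite mulrAC -[X in _ = X]mul1r => /(mulIf Jr0).
have hJ s s' : \sum_t lorentz_sign R t * (h s t * h s' t) =
    lorentz_sign R s *+ (s == s').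
  pose c (s : option 'I_n) := if s is Some _ then 1 else d.
  transitivity (c s * c s' * \sum_t lorentz_sign R t * (g s t * g s' t)).
    by rewrite mulr_sumr; apply: eq_bigr => t _; rewrite /h -/(c s) -/(c s'); ring.
  rewrite gJ; have [<-|_] := eqVneq s s'; last by rewrite mulr0.
  by rewrite !mulr1n; case: s => [?|] /=; rewrite ?dd ?mulr1 ?mul1r.
have detG : \det G = 1.
  have -> : G = diag_mx (\row_i (if opt i is Some _ then 1 else d)) *m G0.
    by apply/matrixP => i k; rewrite mul_diag_mx !mxE.
  rewrite det_mulmx det_diag -/d big_split_ord big_ord1 /= mxE opt_r big1 => [|i _].
    by rewrite mul1r dd.
  by rewrite mxE opt_l.
have JC : map_mx (real_complex R) Jr = J.
  rewrite J_diag /Jr map_diag_mx; congr diag_mx; apply/rowP => i.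
  rewrite -(splitK i) /=; case: (split i) => i' /=.
    by rewrite row_mxEl !mxE opt_l.
  by rewrite row_mxEr !mxE opt_r /= rmorphN.
have conjG : (map_mx (real_complex R) G) ^t* = map_mx (real_complex R) G^T.
  by apply/matrixP => i k; rewrite !mxE; exact: conjc_real.
exists (map_mx (real_complex R) G).
  apply: SU_of_row; last by rewrite det_map_mx detG rmorph1.
  by rewrite conjG -JC -!map_mxM mxJ.
by split=> [j i|j]; rewrite !mxE ?opt_l ?opt_r /h mul1r.
Qed.

End Orbit.

(** * The inequalities describing the moment polytope *)

Local Open Scope classical_set_scope.

Theorem theorem7p7 (R : realType) (n : nat) (hn : (2 <= n)%N)
    (Lambda : dualsp (tor R n)) (hLambda : Chol Lambda) :
  Delta_K Lambda =
  [set xi : dualsp (tor R n) |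
    chamber xi /\
    (forall k : 'I_n, pairing (lambda_t R k) xi >= pairing (lambda_t R k) Lambda) /\
    (forall k l : 'I_n, l = k.+1 :> nat ->
      pairing (lambda_t R k) Lambda >= pairing (lambda_t R l) xi)].
Proof.
have [x Lx] := tor_ofP (sharp Lambda).
have [/(chamber_coord Lx) x_mono x_neg] := hLambda.
pose z := - \sum_j x 0 j.
(* The holomorphic chamber condition puts [z], the last diagonal entry, above every [x 0 i]. *)
have xz i : x 0 i < z.
  have := x_neg (beta R i) (imageT _ i).
  by rewrite (inner_beta i Lx) oppr_gt0 -ltrBrDr sub0r.
have c0 : - (2 * (n + 1)%:R ^+ 2) < 0 :> R.
  by rewrite oppr_lt0 mulr_gt0 ?exprn_gt0 ?ltr0n // addn1.
have below (xi : dualsp (tor R n)) y k l : sharp xi = tor_of y ->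
    (pairing (lambda_t R k) Lambda <= pairing (lambda_t R l) xi) = (y 0 l <= x 0 k).
  move=> xiy; exact: etrans (congr2 (fun u v : R => u <= v)
    (pairing_lambda k Lx) (pairing_lambda l xiy)) (ler_nM2l c0 _ _).
have above (xi : dualsp (tor R n)) y k l : sharp xi = tor_of y ->
    (pairing (lambda_t R l) xi <= pairing (lambda_t R k) Lambda) = (x 0 k <= y 0 l).
  move=> xiy; exact: etrans (congr2 (fun u v : R => u <= v)
    (pairing_lambda l xiy) (pairing_lambda k Lx)) (ler_nM2l c0 _ _).
apply/seteqP; split=> xi; have [y xiy] := tor_ofP (sharp xi).
  move=> /((Delta_KE Lx xiy).1)[ch [g sg gE]].
  split; first exact: ch.
  have y_mono := (chamber_coord xiy).1 ch.
  pose p j i : R[i] := g (lshift 1 j) (lshift 1 i).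
  pose q j : R[i] := g (lshift 1 j) (rshift n 0).
  have orth j k : \sum_i p j i * Num.conj (p k i) - q j * Num.conj (q k) =
      (j == k)%:R.
    (* The identity as diagonal matrix yields the [J]-orthonormality of the first [n] rows of
       [g]. *)
    have := conj_block_entry (const_mx 1) j k sg.
    rewrite diag_const_mx mulmx1 mulmxV ?SU_unit // !mxE mul1r.
    rewrite (inj_eq (@lshift_inj _ _)) => ->.
    by congr (_ - _); apply: eq_bigr => i _; rewrite mxE mul1r.
  have diag j k : \sum_i (x 0 i)%:C * (p j i * Num.conj (p k i))
      - z%:C * (q j * Num.conj (q k)) = (y 0 j)%:C *+ (j == k).
    have := conj_block_entry (tor_diag x) j k sg; rewrite gE tor_diagr !mxE => ->.
    by congr (_ - _); apply: eq_bigr => i _; rewrite tor_diagl.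
  have xC (i j : 'I_n) : (i <= j)%N -> (x 0 i)%:C <= (x 0 j)%:C.
    by move=> ij; rewrite lecR x_mono.
  have yC (i j : 'I_n) : (i <= j)%N -> (y 0 i)%:C <= (y 0 j)%:C.
    by move=> ij; rewrite lecR y_mono.
  have zC i : (x 0 i)%:C <= z%:C by rewrite lecR ltW.
  split=> [k|k l lk].
    rewrite (below _ _ _ _ xiy).
    by have := interlace_below orth diag xC yC zC k; rewrite lecR.
  rewrite (above _ _ _ _ xiy).
  by have := interlace_above orth diag xC yC lk; rewrite lecR.
case=> ch [le_yx le_xy]; apply: (Delta_KE Lx xiy).2; split; first exact: ch.
have y_mono := (chamber_coord xiy).1 ch.
(* Monotonicity of [y] extends the inequalities between neighbours to all pairs of indices. *)
have yx (i j : 'I_n) : (j <= i)%N -> y 0 j <= x 0 i.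
  move=> ji; apply: le_trans (y_mono _ _ ji) _.
  by rewrite -(below _ _ _ _ xiy); apply: le_yx.
have xy (i j : 'I_n) : (i < j)%N -> x 0 i <= y 0 j.
  move=> ij; have i1n : (i.+1 < n)%N := leq_ltn_trans ij (ltn_ord j).
  apply: le_trans (y_mono (Ordinal i1n) _ ij).
  by rewrite -(above _ _ _ _ xiy); apply: le_xy.
have [g gJ gD] := interlacing_pseudo_orthogonal yx xy xz.
have [G sG [Gl Gr]] := SU_of_pseudo_orthogonal gJ.
exists G => //; apply/matrixP => j k.
rewrite conj_block_entry // !Gr tor_diagr [RHS]mxE [map_mx _ _ _ _]mxE.
have conjR (a : R) : Num.conj (a%:C : R[i]) = a%:C by exact: conjc_real.
rewrite -rmorphMn -gD big_option /= conjR -/z -[-1 * _ * _]mulrA mulN1r.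
under eq_bigr do rewrite !Gl tor_diagl conjR.
rewrite rmorphD [in RHS]rmorphN rmorph_sum /= !rmorphM addrC; congr (_ + _).
by apply: eq_bigr => i _; rewrite mul1r !rmorphM.
Qed.
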